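(* Let $(\mathcal{A},[\cdot,\cdot],\diamond,\cdot,\succ)$ be a (left) post-Poisson superalgebra over $\mathbb{K}$. Define even bilinear maps $\{\,,\},\bullet$ on $\mathcal{A}$ by $$\{x,y\}=x\diamond y-(-1)^{|x||y|}y\diamond x+[x,y],\qquad x\bullet y=x\succ y+(-1)^{|x||y|}y\succ x+x\cdot y$$ for homogeneous $x,y\in\mathcal{A}$. Then $(\mathcal{A},\{\,,\},\bullet)$ is a Poisson superalgebra; it is denoted by $P(\mathcal{A})$. Moreover, with $L_\diamond(x)y=x\diamond y$ and $L_\succ(x)y=x\succ y$, $(\mathcal{A},[\cdot,\cdot],\cdot,L_\diamond,L_\succ)$ is a $P(\mathcal{A})$-module Poisson superalgebra.
   Context: $\mathbb{K}$ is a field of characteristic $0$; $|x|\in\mathbb{Z}_2$ is the parity of a homogeneous element; identities are for homogeneous elements. A Poisson superalgebra $(\mathcal{P},\{\,,\},\bullet)$ is a $\mathbb{Z}_2$-graded vector space with two even bilinear maps such that: (i) $\{x,y\}=-(-1)^{|x||y|}\{y,x\}$ and $(-1)^{|x||z|}\{x,\{y,z\}\}+(-1)^{|z||y|}\{z,\{x,y\}\}+(-1)^{|y||x|}\{y,\{z,x\}\}=0$; (ii) $x\bullet y=(-1)^{|x||y|}y\bullet x$ and $x\bullet(y\bullet z)=(x\bullet y)\bullet z$; (iii) $\{x,y\bullet z\}=\{x,y\}\bullet z+(-1)^{|x||y|}y\bullet\{x,z\}$. A (left) post-Poisson superalgebra is a $\mathbb{Z}_2$-graded vector space $\mathcal{A}$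 with four even bilinear operations $[\cdot,\cdot],\diamond,\cdot,\succ$ such that: (post-Lie) $[\cdot,\cdot]$ is a Lie superbracket (as in (i)); $(-1)^{|z||y|}z\diamond(y\diamond x)-y\diamond(z\diamond x)+(y\diamond z)\diamond x-(-1)^{|z||y|}(z\diamond y)\diamond x+[y,z]\diamond x=0$; $z\diamond[x,y]-[z\diamond x,y]-(-1)^{|z||x|}[x,z\diamond y]=0$; (commutative dendriform supertrialgebra) $x\cdot y=(-1)^{|x||y|}y\cdot x$; $(x\cdot y)\cdot z=x\cdot(y\cdot z)$; $x\succ(y\succ z)=(x\succ y+(-1)^{|x||y|}y\succ x+x\cdot y)\succ z$; $(x\succ y)\cdot z=x\succ(y\cdot z)$; (compatibility) $[x,y\cdot z]=[x,y]\cdot z+(-1)^{|x||y|}y\cdot[x,z]$; $[x,z\succ y]=(-1)^{|x||z|}z\succ[x,y]-(-1)^{|y||z|+|x||y|+|x||z|}y\cdot(z\diamond x)$; $x\diamond(y\cdot z)=(x\diamond y)\cdot z+(-1)^{|x||y|}y\cdot(x\diamond z)$; $(y\succ z+(-1)^{|y||z|}z\succ y+y\cdot z)\diamond x=(-1)^{|y||z|}z\succ(y\diamond x)+y\succ(z\diamond x)$; $x\diamond(z\succ y)=(-1)^{|x||z|}z\succ(x\diamond y)+(x\diamond z-(-1)^{|x||z|}z\diamond x+[x,z])\succ y$. Given Poisson superalgebras $(\mathcal{P},\{\,,\},\bullet)$, $(V,\{\,,\}_1,\bullet_1)$ and even linear maps $\psi_{\{,\}},\psi_\bullet:\mathcal{P}\to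 End(V)$, the tuple $(V,\{\,,\}_1,\bullet_1,\psi_{\{,\}},\psi_\bullet)$ is a $\mathcal{P}$-module Poisson superalgebra if for $x,y\in\mathcal{P}$, $u,v\in V$: (1) $\psi_{\{,\}}(\{x,y\})=\psi_{\{,\}}(x)\psi_{\{,\}}(y)-(-1)^{|x||y|}\psi_{\{,\}}(y)\psi_{\{,\}}(x)$ and $\psi_{\{,\}}(x)\{u,v\}_1=\{\psi_{\{,\}}(x)u,v\}_1+(-1)^{|x||u|}\{u,\psi_{\{,\}}(x)v\}_1$; (2) $\psi_\bullet(x\bullet y)=\psi_\bullet(x)\psi_\bullet(y)$ and $\psi_\bullet(x)(u\bullet_1v)=(\psi_\bullet(x)u)\bullet_1v$; (3) $\psi_{\{,\}}(x\bullet y)=\psi_\bullet(x)\psi_{\{,\}}(y)+(-1)^{|x||y|}\psi_\bullet(y)\psi_{\{,\}}(x)$ and $\psi_\bullet(\{x,y\})=\psi_{\{,\}}(x)\psi_\bullet(y)-(-1)^{|x||y|}\psi_\bullet(y)\psi_{\{,\}}(x)$; (4) $\psi_{\{,\}}(x)(u\bullet_1v)=(\psi_{\{,\}}(x)u)\bullet_1v+(-1)^{|x||u|}u\bullet_1(\psi_{\{,\}}(x)v)$ and $\psi_\bullet(x)\{u,v\}_1=(\psi_{\{,\}}(x)u)\bullet_1v+(-1)^{|x||u|}\{u,\psi_\bullet(x)v\}_1$. *)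

(* Defs.v *)
From HB Require Import structures.
From mathcomp Require Import all_boot all_order all_algebra.

Set Implicit Arguments.
Unset Strict Implicit.
Unset Printing Implicit Defensive.

Import GRing.Theory.
Local Open Scope ring_scope.

(* A Z_2-graded vector space V = V_0 (+) V_1 of arbitrary dimension. The
   components of a vector in the direct sum are part of the data; they are
   determined by the two subspaces. *)
HB.mixin Record isZ2Graded (K : fieldType) V of GRing.Lmodule K V := {
  part : 'Z_2 -> {pred V};
  hcomp : 'Z_2 -> V -> V;
  part_submod_closed : forall i, submod_closed (part i);
  hcomp_part : forall i x, hcomp i x \in part i;
  sum_hcomp : forall x, \sum_i hcomp i x = x;
  hcomp_sum : forall u : 'Z_2 -> V, (forall i, u i \in part i) ->
    forall i, hcomp i (\sum_j u j) = u i
}.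

#[short(type="superModType")]
HB.structure Definition SuperModule (K : fieldType) :=
  {V of isZ2Graded K V & GRing.Lmodule K V}.

Arguments part {K V} i : rename.
Arguments hcomp {K V} i x : rename.

(* Parities are elements of 'Z_2; in an exponent of -1 they are read as natural
   numbers 0 and 1, so that (-1) ^+ (i * j) is (-1)^{|x||y|}. Identities on
   homogeneous elements are quantified over the parities and the vectors of
   those parities (so the zero vector is tested with both parities). *)

(* With f : P -> V -> V seen as a map P -> End(V), the second condition also
   says that this map is even for the grading of End(V) by degree. *)
Definition even_bilinear (K : fieldType) (U V W : superModType K)
    (f : U -> V -> W) : Prop :=
  bilinear_for *:%R *:%R f /\
  forall i j : 'Z_2, {in part i & part j, forall x y, f x y \in part (i + j)}.

Section SuperAlgebras.
Context {K : fieldType} {A : superModType K}.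
Implicit Types (i j k : 'Z_2).

Section Lie.
Context (br : A -> A -> A).
Local Notation "{{ x , y }}" := (br x y) (at level 0, x, y at level 99).

Record is_lie_superalgebra : Prop := IsLieSuperalgebra {
  lie_even_bilinear : even_bilinear br;
  lie_skew : forall i j, {in part i & part j, forall x y,
    {{x, y}} = - ((-1) ^+ (i * j) *: {{y, x}})};
  lie_jacobi : forall i j k, {in part i & part j & part k, forall x y z,
    (-1) ^+ (i * k) *: {{x, {{y, z}}}} + (-1) ^+ (k * j) *: {{z, {{x, y}}}}
      + (-1) ^+ (j * i) *: {{y, {{z, x}}}} = 0}
}.

End Lie.

Record is_comm_assoc_superalgebra (mul : A -> A -> A) : Prop :=
  IsCommAssocSuperalgebra {
  mul_even_bilinear : even_bilinear mul;
  mul_supercomm : forall i j, {in part i & part j, forall x y,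
    mul x y = (-1) ^+ (i * j) *: mul y x};
  mul_assoc : forall i j k, {in part i & part j & part k, forall x y z,
    mul x (mul y z) = mul (mul x y) z}
}.

Definition super_leibniz (br mul : A -> A -> A) : Prop :=
  forall i j k, {in part i & part j & part k, forall x y z,
    br x (mul y z) = mul (br x y) z + (-1) ^+ (i * j) *: mul y (br x z)}.

Record is_poisson_superalgebra (br mul : A -> A -> A) : Prop :=
  IsPoissonSuperalgebra {
  poisson_lie : is_lie_superalgebra br;
  poisson_comm_assoc : is_comm_assoc_superalgebra mul;
  poisson_leibniz : super_leibniz br mul
}.

Section PostPoisson.
Context (lie dia dot suc : A -> A -> A).
Local Notation "[[ x , y ]]" := (lie x y) (at level 0, x, y at level 99).
Local Notation "x '◇' y" := (dia x y) (at level 40, y at next level).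
Local Notation "x '⋅' y" := (dot x y) (at level 40, y at next level).
Local Notation "x '≻' y" := (suc x y) (at level 40, y at next level).

Record is_post_lie_superalgebra : Prop := IsPostLieSuperalgebra {
  post_lie_lie : is_lie_superalgebra lie;
  post_lie_even_bilinear : even_bilinear dia;
  post_lie_bracket_dia :
    forall i j k, {in part i & part j & part k, forall x y z,
      (-1) ^+ (k * j) *: (z ◇ (y ◇ x)) - y ◇ (z ◇ x) + (y ◇ z) ◇ x
        - (-1) ^+ (k * j) *: ((z ◇ y) ◇ x) + [[y, z]] ◇ x = 0};
  post_lie_derivation :
    forall i j k, {in part i & part j & part k, forall x y z,
      z ◇ [[x, y]] - [[z ◇ x, y]] - (-1) ^+ (k * i) *: [[x, z ◇ y]] = 0}
}.

Record is_comm_dendriform_supertrialgebra : Prop :=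
  IsCommDendriformSupertrialgebra {
  tridend_dot_even_bilinear : even_bilinear dot;
  tridend_suc_even_bilinear : even_bilinear suc;
  tridend_dot_supercomm : forall i j, {in part i & part j, forall x y,
    x ⋅ y = (-1) ^+ (i * j) *: (y ⋅ x)};
  tridend_dot_assoc :
    forall i j k, {in part i & part j & part k, forall x y z,
      (x ⋅ y) ⋅ z = x ⋅ (y ⋅ z)};
  tridend_suc_suc :
    forall i j k, {in part i & part j & part k, forall x y z,
      x ≻ (y ≻ z) = (x ≻ y + (-1) ^+ (i * j) *: (y ≻ x) + x ⋅ y) ≻ z};
  tridend_suc_dot :
    forall i j k, {in part i & part j & part k, forall x y z,
      (x ≻ y) ⋅ z = x ≻ (y ⋅ z)}
}.

Record is_post_poisson_superalgebra : Prop := IsPostPoissonSuperalgebra {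
  post_poisson_post_lie : is_post_lie_superalgebra;
  post_poisson_tridend : is_comm_dendriform_supertrialgebra;
  post_poisson_lie_dot :
    forall i j k, {in part i & part j & part k, forall x y z,
      [[x, y ⋅ z]] = [[x, y]] ⋅ z + (-1) ^+ (i * j) *: (y ⋅ [[x, z]])};
  post_poisson_lie_suc :
    forall i j k, {in part i & part j & part k, forall x y z,
      [[x, z ≻ y]] = (-1) ^+ (i * k) *: (z ≻ [[x, y]])
        - (-1) ^+ (j * k + i * j + i * k) *: (y ⋅ (z ◇ x))};
  post_poisson_dia_dot :
    forall i j k, {in part i & part j & part k, forall x y z,
      x ◇ (y ⋅ z) = (x ◇ y) ⋅ z + (-1) ^+ (i * j) *: (y ⋅ (x ◇ z))};
  post_poisson_mul_dia :
    forall i j k, {in part i & part j & part k, forall x y z,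
      (y ≻ z + (-1) ^+ (j * k) *: (z ≻ y) + y ⋅ z) ◇ x
        = (-1) ^+ (j * k) *: (z ≻ (y ◇ x)) + y ≻ (z ◇ x)};
  post_poisson_dia_suc :
    forall i j k, {in part i & part j & part k, forall x y z,
      x ◇ (z ≻ y) = (-1) ^+ (i * k) *: (z ≻ (x ◇ y))
        + (x ◇ z - (-1) ^+ (i * k) *: (z ◇ x) + [[x, z]]) ≻ y}
}.

(* The operations of P(A), extended bilinearly from homogeneous elements; see
   post_bracketE and post_mulE. *)
Definition post_bracket (x y : A) : A :=
  \sum_(i : 'Z_2) \sum_(j : 'Z_2)
    (hcomp i x ◇ hcomp j y - (-1) ^+ (i * j) *: (hcomp j y ◇ hcomp i x)
       + [[hcomp i x, hcomp j y]]).

Definition post_mul (x y : A) : A :=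
  \sum_(i : 'Z_2) \sum_(j : 'Z_2)
    (hcomp i x ≻ hcomp j y + (-1) ^+ (i * j) *: (hcomp j y ≻ hcomp i x)
       + hcomp i x ⋅ hcomp j y).

End PostPoisson.

Definition left_mul (op : A -> A -> A) (x : A) : A -> A := fun y => op x y.

Lemma hcomp_homog i (x : A) : x \in part i ->
  forall j, hcomp j x = if j == i then x else 0.
Proof.
move=> xi j; pose u (l : 'Z_2) : A := if l == i then x else 0.
have uP l : u l \in part l.
  by rewrite /u; case: eqP => [->//|_]; have [] := part_submod_closed (s := A) l.
by rewrite -[RHS](hcomp_sum u uP) /u -big_mkcond big_pred1_eq.
Qed.

Lemma sum_hcomp_homog (F : 'Z_2 -> 'Z_2 -> A -> A -> A) :
    (forall i j x, F i j x 0 = 0) -> (forall i j y, F i j 0 y = 0) ->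
  forall i j, {in part i & part j, forall x y,
    \sum_k \sum_l F k l (hcomp k x) (hcomp l y) = F i j x y}.
Proof.
move=> F0r F0l i j x y xi yj; rewrite (bigD1 i) //= (bigD1 j) //=.
rewrite !(hcomp_homog xi) !(hcomp_homog yj) !eqxx big1 => [|l /negPf lj].
  rewrite addr0 big1 ?addr0 // => k /negPf ki.
  by rewrite (hcomp_homog xi) ki big1.
by rewrite (hcomp_homog yj) lj.
Qed.

Lemma even_bilinear0 (f : A -> A -> A) : even_bilinear f ->
  (forall x, f x 0 = 0) /\ (forall y, f 0 y = 0).
Proof.
case=> -[fl fr] _; split=> x.
  by have := fr x (-1) 0 0; rewrite /= scaler0 addr0 /= scaleN1r addNr.
by have := fl x (-1) 0 0; rewrite /= scaler0 addr0 /= scaleN1r addNr.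
Qed.

Lemma post_bracketE (lie dia : A -> A -> A) :
    even_bilinear lie -> even_bilinear dia ->
  forall i j, {in part i & part j, forall x y,
    post_bracket lie dia x y = dia x y - (-1) ^+ (i * j) *: dia y x + lie x y}.
Proof.
move=> /even_bilinear0[l0 l0'] /even_bilinear0[d0 d0'] i j x y xi yj.
pose F (k l : 'Z_2) a b := dia a b - (-1) ^+ (k * l) *: dia b a + lie a b.
by apply: (sum_hcomp_homog (F := F)) xi yj => k l a;
   rewrite /F ?l0 ?l0' d0 d0' scaler0 subr0 addr0.
Qed.

Lemma post_mulE (dot suc : A -> A -> A) :
    even_bilinear dot -> even_bilinear suc ->
  forall i j, {in part i & part j, forall x y,
    post_mul dot suc x y = suc x y + (-1) ^+ (i * j) *: suc y x + dot x y}.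
Proof.
move=> /even_bilinear0[l0 l0'] /even_bilinear0[d0 d0'] i j x y xi yj.
pose F (k l : 'Z_2) a b := suc a b + (-1) ^+ (k * l) *: suc b a + dot a b.
by apply: (sum_hcomp_homog (F := F)) xi yj => k l a;
   rewrite /F ?l0 ?l0' d0 d0' scaler0 !addr0.
Qed.

End SuperAlgebras.

(* Equalities in End(V) are stated pointwise on all of V. The term
   mul1 (psibr x u) v in module_mul_bracket is not a misprint for
   br1 (psibr x u) v: it is what the Leibniz rule on the direct sum of P and V
   gives for {u, x * v}. *)
Record is_module_poisson_superalgebra (K : fieldType) (P V : superModType K)
    (brP mulP : P -> P -> P) (br1 mul1 : V -> V -> V)
    (psibr psimul : P -> V -> V) : Prop := IsModulePoissonSuperalgebra {
  module_base_poisson : is_poisson_superalgebra brP mulP;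
  module_poisson : is_poisson_superalgebra br1 mul1;
  module_br_even_bilinear : even_bilinear psibr;
  module_mul_even_bilinear : even_bilinear psimul;
  module_br_rep :
    forall i j : 'Z_2, {in part i & part j, forall x y, forall u,
      psibr (brP x y) u
        = psibr x (psibr y u) - (-1) ^+ (i * j) *: psibr y (psibr x u)};
  module_br_bracket :
    forall i j k : 'Z_2, {in part i & part j & part k, forall x u v,
      psibr x (br1 u v)
        = br1 (psibr x u) v + (-1) ^+ (i * j) *: br1 u (psibr x v)};
  module_mul_rep :
    forall i j : 'Z_2, {in part i & part j, forall x y, forall u,
      psimul (mulP x y) u = psimul x (psimul y u)};
  module_mul_mul :
    forall i j k : 'Z_2, {in part i & part j & part k, forall x u v,
      psimul x (mul1 u v) = mul1 (psimul x u) v};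
  module_br_mulP :
    forall i j : 'Z_2, {in part i & part j, forall x y, forall u,
      psibr (mulP x y) u
        = psimul x (psibr y u) + (-1) ^+ (i * j) *: psimul y (psibr x u)};
  module_mul_brP :
    forall i j : 'Z_2, {in part i & part j, forall x y, forall u,
      psimul (brP x y) u
        = psibr x (psimul y u) - (-1) ^+ (i * j) *: psimul y (psibr x u)};
  module_br_mul :
    forall i j k : 'Z_2, {in part i & part j & part k, forall x u v,
      psibr x (mul1 u v)
        = mul1 (psibr x u) v + (-1) ^+ (i * j) *: mul1 u (psibr x v)};
  module_mul_bracket :
    forall i j k : 'Z_2, {in part i & part j & part k, forall x u v,
      psimul x (br1 u v)
        = mul1 (psibr x u) v + (-1) ^+ (i * j) *: br1 u (psimul x v)}
}.

(* Main.v *)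
(* The post-Lie and tridendriform axioms and the compatibilities say that the
   left multiplications by {x, y} and x • y are the prescribed combinations
   of the left multiplications by x and y, i.e. that A is a module over P(A).
   With these module identities as rewrite rules, each axiom of P(A) becomes an
   equality of signed sums of the same monomials. *)
Require Import Defs.
From HB Require Import structures.
From mathcomp Require Import all_boot all_order all_algebra.

Set Implicit Arguments.
Unset Strict Implicit.
Unset Printing Implicit Defensive.

Import GRing.Theory.
Local Open Scope ring_scope.

(** * Reflexive check of equalities between signed sums in an abelian group *)

Inductive zmod_expr :=
  | ZVar of nat
  | ZZero
  | ZAdd of zmod_expr & zmod_expr
  | ZOpp of zmod_expr.

Fixpoint zmod_eval (V : zmodType) (env : seq V) (e : zmod_expr) : V :=
  match e with
  | ZVar n => env`_n
  | ZZero => 0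
  | ZAdd e1 e2 => zmod_eval env e1 + zmod_eval env e2
  | ZOpp e1 => - zmod_eval env e1
  end.

Fixpoint zmod_coef (e : zmod_expr) (n : nat) : int :=
  match e with
  | ZVar m => if m == n then 1 else 0
  | ZZero => 0
  | ZAdd e1 e2 => zmod_coef e1 n + zmod_coef e2 n
  | ZOpp e1 => - zmod_coef e1 n
  end.

Lemma zmod_eval_sum (V : zmodType) (env : seq V) (e : zmod_expr) :
  zmod_eval env e = \sum_(n < size env) env`_n *~ zmod_coef e n.
Proof.
elim: e => [m||e1 IH1 e2 IH2|e1 IH1] /=.
- have [lt_m|le_m] := ltnP m (size env).
    rewrite (bigD1 (Ordinal lt_m)) //= eqxx big1 ?addr0 // => n ne_n.
    by case: eqP => // eq_m; case/eqP: ne_n; apply: val_inj.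
  (* An index past the end of [env] denotes the default value 0, and no index of the sum equals
     it. *)
  rewrite nth_default // big1 // => n _.
  by rewrite gtn_eqF // (leq_trans (ltn_ord n)).
- by rewrite big1.
- by rewrite IH1 IH2 -big_split; apply: eq_bigr => n _; rewrite mulrzDr.
- by rewrite IH1 -sumrN; apply: eq_bigr => n _; rewrite mulrNz.
Qed.

(** An expression evaluates to an integer combination of the atoms, so agreement of the computable
    coefficients gives equality in every abelian group. *)
Lemma zmod_eval_eq (V : zmodType) (env : seq V) (e1 e2 : zmod_expr) :
    all (fun n => zmod_coef e1 n == zmod_coef e2 n) (iota 0 (size env)) ->
  zmod_eval env e1 = zmod_eval env e2.
Proof.
move=> /allP eq_coef; rewrite !zmod_eval_sum; apply: eq_bigr => n _.
by have := eq_coef n; rewrite mem_iota ltn_ord => /(_ isT)/eqP->.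
Qed.

(* Atoms are compared up to conversion, since rewriting can leave different but
   convertible structure instances on equal terms. *)
Ltac zmod_mem t env :=
  lazymatch env with
  | nil => constr:(false)
  | ?u :: ?env' =>
      match constr:(tt) with
      | _ => let _ := constr:(erefl t : t = u) in constr:(true)
      | _ => zmod_mem t env'
      end
  end.

Ltac zmod_atoms env t :=
  lazymatch t with
  | @Algebra.add _ ?x ?y => let env' := zmod_atoms env x in zmod_atoms env' y
  | @Algebra.opp _ ?x => zmod_atoms env x
  | @Algebra.zero _ => env
  | _ => lazymatch zmod_mem t env with
         | true => env
         | false => constr:(t :: env)
         end
  end.

Ltac zmod_index t env :=
  lazymatch env with
  | ?u :: ?env' =>
      match constr:(tt) with
      | _ => let _ := constr:(erefl t : t = u) in constr:(0%N)
      | _ => let n := zmod_index t env' in constr:(n.+1)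
      end
  end.

Ltac zmod_reify env t :=
  lazymatch t with
  | @Algebra.add _ ?x ?y =>
      let e1 := zmod_reify env x in let e2 := zmod_reify env y in
      constr:(ZAdd e1 e2)
  | @Algebra.opp _ ?x => let e := zmod_reify env x in constr:(ZOpp e)
  | @Algebra.zero _ => constr:(ZZero)
  | _ => let n := zmod_index t env in constr:(ZVar n)
  end.

(** Scalings and products count as atoms, so signs must be evaluated and operations expanded before
    the call. *)
Ltac zmod :=
  lazymatch goal with
  | |- @eq ?V ?x ?y =>
      let env0 := zmod_atoms (@nil V) x in
      let env := zmod_atoms env0 y in
      let e1 := zmod_reify env x in
      let e2 := zmod_reify env y in
      refine (@zmod_eval_eq _ env e1 e2 _); vm_compute; reflexivity
  end.

(** * Signs as functions of the parities *)

Section Signs.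
Context {K : fieldType}.
Implicit Types i j k : 'Z_2.

(** The sum [i + j] is reduced modulo 2, while exponents add as natural numbers. Only the parity of
    an exponent matters, and the values of [i] and [j] are checked case by case. *)
Lemma sign_mulDl i j k :
  (-1 : K) ^+ ((i + j)%R * k) = (-1) ^+ (i * k) * (-1) ^+ (j * k).
Proof.
rewrite -exprD -mulnDl -[LHS]signr_odd -[RHS]signr_odd !oddM.
by congr (_ ^+ (_ && _));
   case: i => [[|[|i]] //= lti]; case: j => [[|[|j]] //= ltj].
Qed.

Lemma sign_mulDr i j k :
  (-1 : K) ^+ (k * (i + j)%R) = (-1) ^+ (k * i) * (-1) ^+ (k * j).
Proof. by rewrite mulnC sign_mulDl !(mulnC k). Qed.

Lemma sign_cases n : (-1 : K) ^+ n = 1 \/ (-1 : K) ^+ n = -1.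
Proof. by rewrite -signr_odd; case: (odd n); [right|left]. Qed.

End Signs.

(** * Homogeneous decomposition and even bilinear maps *)

Section Graded.
Context {K : fieldType} {A : superModType K}.
Implicit Types (i j k : 'Z_2) (x y z u v : A) (a : K).

Lemma part0 i : (0 : A) \in part i.
Proof. by have [] := part_submod_closed (s := A) i. Qed.

Lemma part_linear i a x y :
  x \in part i -> y \in part i -> a *: x + y \in part i.
Proof. by have [_] := part_submod_closed (s := A) i; apply. Qed.

Lemma partD i x y : x \in part i -> y \in part i -> x + y \in part i.
Proof. by rewrite -{2}[x]scale1r; apply: part_linear. Qed.

Lemma partZ i a x : x \in part i -> a *: x \in part i.
Proof. by move=> xi; rewrite -[_ *: _]addr0 part_linear ?part0. Qed.

Lemma partN i x : x \in part i -> - x \in part i.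
Proof. by rewrite -scaleN1r; apply: partZ. Qed.

(** The combinations of the components of [x] and [y] form a homogeneous decomposition of
    [a *: x + y], and such a decomposition is unique. *)
Lemma hcomp_linear i a x y : hcomp i (a *: x + y) = a *: hcomp i x + hcomp i y.
Proof.
rewrite -{1}[x]sum_hcomp -{1}[y]sum_hcomp scaler_sumr -big_split.
by rewrite hcomp_sum // => j; rewrite part_linear ?hcomp_part.
Qed.

(** Carries the axioms, which are given for homogeneous vectors, over to the module identities,
    which are stated for every vector acted upon. *)
Lemma homog_ind (P : A -> Prop) :
    (forall k u, u \in part k -> P u) ->
    (forall u v, P u -> P v -> P (u + v)) ->
  forall u, P u.
Proof.
move=> Phom PD u; rewrite -[u]sum_hcomp; apply: big_ind => // [|k _].
  exact: Phom (part0 0).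
exact: Phom (hcomp_part k u).
Qed.

Lemma bilinear_for_scale (f : A -> A -> A) :
    (forall a x y z, f (a *: x + y) z = a *: f x z + f y z) ->
    (forall a x y z, f z (a *: x + y) = a *: f z x + f z y) ->
  bilinear_for *:%R *:%R f.
Proof. by move=> fl fr; split=> [z|z] a x y; [apply: fl|apply: fr]. Qed.

(** The sign in the operations of P(A) depends on the parities, so these operations are glued from
    one bilinear map per pair of parities. Linearity of [hcomp] keeps the result bilinear. *)
Lemma bilinear_sum_hcomp (F : 'Z_2 -> 'Z_2 -> A -> A -> A) :
    (forall i j, bilinear_for *:%R *:%R (F i j)) ->
  bilinear_for *:%R *:%R
    (fun x y => \sum_i \sum_j F i j (hcomp i x) (hcomp j y)).
Proof.
move=> Fbil; split=> [y|x] a u v /=;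
  rewrite scaler_sumr -big_split; apply: eq_bigr => i _ /=;
  rewrite scaler_sumr -big_split; apply: eq_bigr => j _ /=;
  rewrite hcomp_linear; have [Fl Fr] := Fbil i j; [exact: Fl|exact: Fr].
Qed.

Section EvenBilinear.
Context (f : A -> A -> A) (f_even : even_bilinear f).

Lemma even_bilinear_part i j x y :
  x \in part i -> y \in part j -> f x y \in part (i + j).
Proof. by case: f_even => _ f_part; apply: f_part. Qed.

Lemma even_bilinear_linearl a x y z : f (a *: x + y) z = a *: f x z + f y z.
Proof. by case: f_even => -[fl _] _; apply: fl. Qed.

Lemma even_bilinear_linearr a x y z : f z (a *: x + y) = a *: f z x + f z y.
Proof. by case: f_even => -[_ fr] _; apply: fr. Qed.

Lemma even_bilinearDl x y z : f (x + y) z = f x z + f y z.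
Proof. by rewrite -[x]scale1r even_bilinear_linearl !scale1r. Qed.

Lemma even_bilinearDr x y z : f z (x + y) = f z x + f z y.
Proof. by rewrite -[x]scale1r even_bilinear_linearr !scale1r. Qed.

Lemma even_bilinearZl a x z : f (a *: x) z = a *: f x z.
Proof.
have [_ f0] := even_bilinear0 f_even.
by rewrite -[_ *: x]addr0 even_bilinear_linearl f0 addr0.
Qed.

Lemma even_bilinearZr a x z : f z (a *: x) = a *: f z x.
Proof.
have [f0 _] := even_bilinear0 f_even.
by rewrite -[_ *: x]addr0 even_bilinear_linearr f0 addr0.
Qed.

Lemma even_bilinearNl x z : f (- x) z = - f x z.
Proof. by rewrite -scaleN1r even_bilinearZl scaleN1r. Qed.

Lemma even_bilinearNr x z : f z (- x) = - f z x.
Proof. by rewrite -scaleN1r even_bilinearZr scaleN1r. Qed.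

Definition even_bilinearE :=
  (even_bilinearDl, even_bilinearDr, even_bilinearNl, even_bilinearNr,
   even_bilinearZl, even_bilinearZr).

End EvenBilinear.
End Graded.

(* Every sign is a product of the three signs (-1)^{|x||y|}, (-1)^{|x||z|} and
   (-1)^{|y||z|}, so it suffices to check the eight values of these. *)
Ltac sign_split K i j k :=
  rewrite ?exprD ?sign_mulDl ?sign_mulDr;
  rewrite ?(mulnC j i) ?(mulnC k i) ?(mulnC k j);
  let s := fresh "s" in
  case: (@sign_cases K (i * j)) => s; rewrite ?{}s;
  case: (@sign_cases K (i * k)) => s; rewrite ?{}s;
  case: (@sign_cases K (j * k)) => s; rewrite ?{}s;
  rewrite ?(mulr1, mul1r, mulrN1, opprK, scale1r, scaleN1r).

(** * The operations of P(A) are even and bilinear *)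

Section PostPoisson.
Context {K : fieldType} {A : superModType K} {lie dia dot suc : A -> A -> A}.
Context (postA : is_post_poisson_superalgebra lie dia dot suc).
Implicit Types (i j k : 'Z_2) (x y z u v : A).

Let plA := post_poisson_post_lie postA.
Let tdA := post_poisson_tridend postA.
Let lieA := post_lie_lie plA.
Let lie_even := lie_even_bilinear lieA.
Let dia_even := post_lie_even_bilinear plA.
Let dot_even := tridend_dot_even_bilinear tdA.
Let suc_even := tridend_suc_even_bilinear tdA.
Let brE := post_bracketE lie_even dia_even.
Let mulE := post_mulE dot_even suc_even.
Let lie_part := even_bilinear_part lie_even.
Let dia_part := even_bilinear_part dia_even.
Let dot_part := even_bilinear_part dot_even.
Let suc_part := even_bilinear_part suc_even.

Let opE := (even_bilinearE lie_even, even_bilinearE dia_even,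
  even_bilinearE dot_even, even_bilinearE suc_even).

Local Notation br := (post_bracket lie dia).
Local Notation mul := (post_mul dot suc).

(** Once the signs are fixed and the operations expanded, the goal must hold with integer
    coefficients on the monomials. *)
Ltac super i j k :=
  sign_split K i j k;
  rewrite ?opE;
  zmod.

Lemma post_bracket_even : even_bilinear br.
Proof.
split=> [|i j x y xi yj].
  apply: (bilinear_sum_hcomp (F := fun i j x y =>
    dia x y - (-1) ^+ (i * j) *: dia y x + lie x y)) => i j.
  apply: bilinear_for_scale => a u v z;
    rewrite !(even_bilinear_linearl lie_even, even_bilinear_linearr lie_even)
      !(even_bilinear_linearl dia_even, even_bilinear_linearr dia_even);
    have [->|->] := @sign_cases K (i * j);
    rewrite ?(scale1r, scaleN1r) !(scalerDr, scalerN); zmod.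
have op_yx : dia y x \in part (i + j) by rewrite addrC dia_part.
by rewrite (brE xi yj) !(partD, partN) ?partZ ?lie_part ?(dia_part xi).
Qed.

Lemma post_mul_even : even_bilinear mul.
Proof.
split=> [|i j x y xi yj].
  apply: (bilinear_sum_hcomp (F := fun i j x y =>
    suc x y + (-1) ^+ (i * j) *: suc y x + dot x y)) => i j.
  apply: bilinear_for_scale => a u v z;
    rewrite !(even_bilinear_linearl dot_even, even_bilinear_linearr dot_even)
      !(even_bilinear_linearl suc_even, even_bilinear_linearr suc_even);
    have [->|->] := @sign_cases K (i * j);
    rewrite ?(scale1r, scaleN1r) !(scalerDr, scalerN); zmod.
have op_yx : suc y x \in part (i + j) by rewrite addrC suc_part.
by rewrite (mulE xi yj) !partD ?partZ ?dot_part ?(suc_part xi).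
Qed.

Let br_part := even_bilinear_part post_bracket_even.
Let mul_part := even_bilinear_part post_mul_even.

(** * The module identities over P(A) *)

Lemma dia_bracket i j x y : x \in part i -> y \in part j -> forall u,
  dia (br x y) u = dia x (dia y u) - (-1) ^+ (i * j) *: dia y (dia x u).
Proof.
move=> xi yj; apply: homog_ind => [k u uk|u v Hu Hv].
  rewrite (brE xi yj); apply/eqP.
  (* The 0 on the right becomes the left side of the post-Lie axiom, so both sides are signed sums
     of the same monomials. *)
  rewrite -subr_eq0 -(post_lie_bracket_dia plA uk xi yj).
  by apply/eqP; super i j k.
(* Only the sign of [i] and [j] occurs, so [j] also fills the third slot. *)
rewrite (even_bilinearDr dia_even) Hu Hv; super i j j.
Qed.

Lemma dia_lie i j k x u v : x \in part i -> u \in part j -> v \in part k ->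
  dia x (lie u v) = lie (dia x u) v + (-1) ^+ (i * j) *: lie u (dia x v).
Proof.
move=> xi uj vk; apply/eqP; rewrite -subr_eq0.
by rewrite -(post_lie_derivation plA uj vk xi) opprD addrA.
Qed.

Lemma suc_mul i j x y : x \in part i -> y \in part j -> forall u,
  suc (mul x y) u = suc x (suc y u).
Proof.
move=> xi yj; apply: homog_ind => [k u uk|u v Hu Hv].
  by rewrite (mulE xi yj) (tridend_suc_suc tdA xi yj uk).
by rewrite !(even_bilinearDr suc_even) Hu Hv.
Qed.

Lemma dia_mul i j x y : x \in part i -> y \in part j -> forall u,
  dia (mul x y) u = suc x (dia y u) + (-1) ^+ (i * j) *: suc y (dia x u).
Proof.
move=> xi yj; apply: homog_ind => [k u uk|u v Hu Hv].
  by rewrite (mulE xi yj) (post_poisson_mul_dia postA uk xi yj) addrC.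
rewrite !(even_bilinearDr dia_even) Hu Hv; super i j j.
Qed.

(** The compatibility axiom for x ◇ (y ≻ u), solved for the term in which {x, y} acts. *)
Lemma suc_bracket i j x y : x \in part i -> y \in part j -> forall u,
  suc (br x y) u = dia x (suc y u) - (-1) ^+ (i * j) *: suc y (dia x u).
Proof.
move=> xi yj; apply: homog_ind => [k u uk|u v Hu Hv].
  rewrite (brE xi yj) (post_poisson_dia_suc postA xi uk yj).
  by rewrite [RHS]addrAC subrr add0r.
rewrite (even_bilinearDr suc_even) Hu Hv; super i j j.
Qed.

(** The axiom for [u, x ≻ v], solved for x ≻ [u, v], with (x ◇ u) ⋅ v reordered by
    supercommutativity. *)
Lemma suc_lie i j k x u v : x \in part i -> u \in part j -> v \in part k ->
  suc x (lie u v) = dot (dia x u) v + (-1) ^+ (i * j) *: lie u (suc x v).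
Proof.
move=> xi uj vk; rewrite (post_poisson_lie_suc postA uj vk xi).
rewrite (tridend_dot_supercomm tdA (dia_part xi uj) vk).
super i j k.
Qed.

(** * The Poisson axioms of P(A) *)

Lemma post_bracket_lie : is_lie_superalgebra br.
Proof.
split=> [|i j x y xi yj|i j k x y z xi yj zk].
- exact: post_bracket_even.
- rewrite (brE xi yj) (brE yj xi) (lie_skew lieA xi yj).
  super i j j.
rewrite (brE xi (br_part yj zk)) (brE yj (br_part zk xi)).
rewrite (brE zk (br_part xi yj)).
rewrite (dia_bracket xi yj) (dia_bracket yj zk) (dia_bracket zk xi).
rewrite (brE xi yj) (brE yj zk) (brE zk xi).
rewrite !(even_bilinearDr dia_even) (dia_lie xi yj zk) (dia_lie yj zk xi).
rewrite (dia_lie zk xi yj).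
(* Skew-symmetry moves every ◇ product inside a bracket to the second argument, which makes equal
   mixed monomials identical. *)
rewrite (lie_skew lieA (dia_part xi yj) zk) (lie_skew lieA (dia_part yj zk) xi).
rewrite (lie_skew lieA (dia_part zk xi) yj).
(* All terms containing ◇ cancel. What survives is the Jacobi sum of [lie], which replaces the 0 on
   the right. *)
rewrite -(lie_jacobi lieA xi yj zk).
super i j k.
Qed.

Lemma post_mul_supercomm i j x y : x \in part i -> y \in part j ->
  mul x y = (-1) ^+ (i * j) *: mul y x.
Proof.
move=> xi yj; rewrite (mulE xi yj) (mulE yj xi).
rewrite (tridend_dot_supercomm tdA xi yj); super i j j.
Qed.

(** By [suc_mul] both sides are actions of products in P(A), and • is supercommutative. *)
Lemma suc_suc_supercomm i j x y : x \in part i -> y \in part j -> forall u,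
  suc x (suc y u) = (-1) ^+ (i * j) *: suc y (suc x u).
Proof.
move=> xi yj u; rewrite -(suc_mul xi yj) -(suc_mul yj xi).
by rewrite (post_mul_supercomm xi yj) (even_bilinearZl suc_even).
Qed.

(** Supercommutativity moves [x] to the right, where (y ≻ z) ⋅ x = y ≻ (z ⋅ x) applies, and then
    back. *)
Lemma dot_suc i j k x y z : x \in part i -> y \in part j -> z \in part k ->
  dot x (suc y z) = (-1) ^+ (i * j) *: suc y (dot x z).
Proof.
move=> xi yj zk; rewrite (tridend_dot_supercomm tdA xi (suc_part yj zk)).
rewrite (tridend_suc_dot tdA yj zk xi) (tridend_dot_supercomm tdA zk xi).
super i j k.
Qed.

Lemma post_mul_comm_assoc : is_comm_assoc_superalgebra mul.
Proof.
split=> [|i j x y|i j k x y z xi yj zk].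
- exact: post_mul_even.
- exact: post_mul_supercomm.
rewrite (mulE xi (mul_part yj zk)) (mulE (mul_part xi yj) zk).
rewrite (suc_mul xi yj) (suc_mul yj zk) (mulE xi yj) (mulE yj zk) !opE.
rewrite (tridend_dot_assoc tdA xi yj zk).
(* Normal form for the remaining monomials: ≻ is pulled outside ⋅, and in iterated actions that of
   [z] is moved innermost. *)
rewrite (dot_suc xi yj zk) (dot_suc xi zk yj).
rewrite (tridend_suc_dot tdA xi yj zk) (tridend_suc_dot tdA yj xi zk).
rewrite (suc_suc_supercomm zk xi) (suc_suc_supercomm zk yj).
super i j k.
Qed.

(** The module identities produce matching terms x ◇ (y ≻ z) and x ◇ (z ≻ y) on both sides. The
    other products on the left, x ◇ (y ⋅ z) and the brackets of [x] with y ⋅ z, y ≻ z and z ≻ y, are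
    expanded by the compatibility axioms. *)
Lemma post_leibniz : super_leibniz br mul.
Proof.
move=> i j k x y z xi yj zk.
rewrite (brE xi (mul_part yj zk)) (mulE (br_part xi yj) zk).
rewrite (mulE yj (br_part xi zk)) (dia_mul yj zk) (mulE yj zk).
rewrite (suc_bracket xi yj) (suc_bracket xi zk) (brE xi yj) (brE xi zk) !opE.
rewrite (post_poisson_dia_dot postA xi yj zk).
rewrite (post_poisson_lie_dot postA xi yj zk).
rewrite (post_poisson_lie_suc postA xi zk yj).
rewrite (post_poisson_lie_suc postA xi yj zk).
(* Matches the term z ⋅ (y ◇ x) coming from the axiom for [x, y ≻ z]. *)
rewrite (tridend_dot_supercomm tdA (dia_part yj xi) zk).
super i j k.
Qed.

End PostPoisson.

Theorem theorem6p1 (K : fieldType) (charK : [pchar K] =i pred0)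
    (A : superModType K) (lie dia dot suc : A -> A -> A)
    (postA : is_post_poisson_superalgebra lie dia dot suc) :
  is_poisson_superalgebra (post_bracket lie dia) (post_mul dot suc) /\
  is_module_poisson_superalgebra (post_bracket lie dia) (post_mul dot suc)
    lie dot (left_mul dia) (left_mul suc).
Proof.
have plA := post_poisson_post_lie postA.
have tdA := post_poisson_tridend postA.
have poissonA :
    is_poisson_superalgebra (post_bracket lie dia) (post_mul dot suc).
  split; [exact: post_bracket_lie postA | exact: post_mul_comm_assoc postA |].
  exact: post_leibniz postA.
split=> //; split=> //.
- split; first exact: post_lie_lie plA; last exact: post_poisson_lie_dot postA.
  split; first exact: tridend_dot_even_bilinear tdA.
    exact: tridend_dot_supercomm tdA.
  by move=> i j k x y z xi yj zk; rewrite (tridend_dot_assoc tdA xi yj zk).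
- exact: post_lie_even_bilinear plA.
- exact: tridend_suc_even_bilinear tdA.
- exact: dia_bracket postA.
- exact: dia_lie postA.
- exact: suc_mul postA.
- move=> i j k x u v xi uj vk.
  by rewrite /left_mul (tridend_suc_dot tdA xi uj vk).
- exact: dia_mul postA.
- exact: suc_bracket postA.
- exact: post_poisson_dia_dot postA.
- exact: suc_lie postA.
Qed.
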